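(* Let $q$ be a prime power and let $P\subseteq[0,q-2]^2$ be an integral convex polytope which is lattice equivalent to $$m[0,e_1]+n[0,e_2]+\ell[0,e_1+e_2],$$ where $m,n,\ell$ are integers with $0\le n\le m\le \ell$. Suppose there is an integer $t$ with $m\le t\le \ell$ such that $t\mid q-1$. Then $$d(C_P)=(q-1)^2-L(P)(q-1)+\ell(m+n)$$ whenever $q-1-M\sqrt{q}>\operatorname{Area}(P)$, where $M=\max\{2\operatorname{Area}(P)-1,\,6\}$.
   Context: An integral convex polytope (lattice polytope) in $\mathbb{R}^2$ is the convex hull of a nonempty finite subset of $\mathbb{Z}^2$. $e_1,e_2$ are the standard basis vectors, $[0,v]$ is the segment from $0$ to $v$, and sums of polytopes are Minkowski sums, with $kA=\{ka:a\in A\}$. Two lattice polytopes $P,Q\subset\mathbb{R}^2$ are lattice equivalent if $T(P)=Q$ for some $T(x)=Ax+\lambda$ with $A\in\mathrm{GL}(2,\mathbb{Z})$, $\lambda\in\mathbb{Z}^2$. The Minkowski length $L(P)$ is the maximum number of non-trivial (at least one-dimensional) lattice polytopes whose Minkowski sum is contained in $P$. $\operatorname{Area}$ is Euclidean area. For a lattice polytope $P\subset\mathbb{R}^2$, $\mathcal{L}_P=\operatorname{span}_{\mathbb{F}_q}\{t^\alpha:\alpha\in P\cap\mathbb{Z}^2\}\subset\mathbb{F}_q[t_1^{\pm1},t_2^{\pm1}]$, and the toric code $C_P\subseteq\mathbb{F}_q^{(q-1)^2}$ is the image of the evaluation map $f\mapsto (f(\gamma))_{\gamma\in(\mathbb{F}_q^\times)^2}$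 on $\mathcal{L}_P$. The minimum distance $d(C)$ of a linear code $C$ is the minimum number of nonzero entries of a nonzero element of $C$. *)

(* Defs.v *)
From HB Require Import structures.
From mathcomp Require Import all_boot all_order all_fingroup all_algebra.
From mathcomp Require Import finmap.
From mathcomp Require Import all_classical all_reals all_analysis.

Set Implicit Arguments.
Unset Strict Implicit.
Unset Printing Implicit Defensive.

Import Order.TTheory GRing.Theory Num.Theory.
Import numFieldNormedType.Exports.

Local Open Scope classical_set_scope.
Local Open Scope ring_scope.

Section Polytopes.
Context {R : realType}.

Notation plane := (R * R)%type.

Definition lattice_pt (a : int * int) : plane := (a.1%:~R, a.2%:~R).

Definition convex_hull (A : set plane) : set plane :=
  smallest (@convex_set R plane) A.

Definition lattice_polytope (P : set plane) : Prop :=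
  exists s : seq (int * int),
    s <> [::] /\ P = convex_hull (lattice_pt @` [set` s]).

Definition minkowski_sum (A B : set plane) : set plane :=
  [set x + y | x in A & y in B].

Definition dilate (k : R) (A : set plane) : set plane :=
  [set k *: x | x in A].

Definition segment0 (v : plane) : set plane := convex_hull [set 0; v].

Definition e1 : plane := (1, 0).
Definition e2 : plane := (0, 1).

Definition affine_map (A : 'M[int]_2) (b : int * int) (x : plane) : plane :=
  ((A 0 0)%:~R * x.1 + (A 0 1)%:~R * x.2,
   (A 1 0)%:~R * x.1 + (A 1 1)%:~R * x.2) + lattice_pt b.

Definition lattice_equivalent (P Q : set plane) : Prop :=
  exists (A : 'M[int]_2) (b : int * int),
    A \in unitmx /\ affine_map A b @` P = Q.

(* A nonempty convex set has dimension at least one iff it is not reduced to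
   a single point. *)
Definition nontrivial (Q : set plane) : Prop :=
  exists x y, [/\ Q x, Q y & x <> y].

(* On a nonempty bounded set of natural numbers [supremum] is the maximum; the
   default [0] is only used when no Minkowski sum is contained in [P] (the
   empty sum being [[set 0]]), e.g. for a one-point [P] off the origin. *)
Definition minkowski_length (P : set plane) : nat :=
  supremum 0%N [set k : nat | exists Q : 'I_k -> set plane,
    (forall i, lattice_polytope (Q i) /\ nontrivial (Q i)) /\
    \big[minkowski_sum/[set 0]]_(i < k) Q i `<=` P].

Definition area (P : set plane) : R :=
  fine ((@lebesgue_measure R \x @lebesgue_measure R)%E P).

End Polytopes.

Section ToricCodes.
Context {R : realType} (F : finFieldType).

(* Laurent polynomials in two variables, as finitely supported families of
   coefficients: [f a] is the coefficient of t_1^(a.1) t_2^(a.2). *)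
Definition laurent : Type := {fsfun int * int -> F with 0}.

Definition torus : finType := ({unit F} * {unit F})%type.

Definition laurent_eval (f : laurent) : {ffun torus -> F} :=
  [ffun g : torus =>
     \sum_(a <- finsupp f) f a * (val g.1 ^ a.1 * val g.2 ^ a.2)].

Definition laurent_space (P : set (R * R)) : set laurent :=
  [set f | forall a, a \in finsupp f -> P (lattice_pt a)].

Definition toric_code (P : set (R * R)) : set {ffun torus -> F} :=
  laurent_eval @` laurent_space P.

End ToricCodes.

Arguments laurent_space {R} F P.
Arguments toric_code {R} F P.

Definition hamming_weight (I : finType) (F : finFieldType)
  (c : {ffun I -> F}) : nat := #|[pred i | c i != 0]|.

(* A minimum over a nonempty set as soon as [C] has a nonzero codeword. *)
Definition min_distance (I : finType) (F : finFieldType)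
  (C : set {ffun I -> F}) : nat :=
  infimum 0%N [set hamming_weight c | c in C `\ 0].

(* Main.v *)
Require Import Defs.
From mathcomp Require Import all_boot all_order all_fingroup all_algebra.
From mathcomp Require Import cyclic finmap zify ring lra.
From mathcomp Require Import all_classical all_reals all_analysis.
From mathcomp Require Import measurable_realfun.

(** Throughout [N = q - 1].

    After an integral change of coordinates the lattice points of [P] are the
    [(u, w)] with [0 <= u + w <= m + l], [0 <= w <= n + l] and
    [- n <= u <= m], and the three kinds of segments point along [(1, 0)],
    [(-1, 1)] and [(0, 1)] ([lattice_equivalent_chart]).  The change of
    coordinates acts on exponents, hence also on the torus by monomial
    automorphisms, which permute the coordinates of codewords and so preserve
    weights ([hamming_weight_torus_chart]).

    Minkowski length ([minkowski_lengthE]).  The linear forms [u], [w] and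
    [u + w] have widths [m + n], [n + l] and [m + l] on the hexagon.  Every
    nontrivial summand contains two lattice points, and on their nonzero
    difference the absolute values of the three forms add up to at least 2.
    So there are at most [m + n + l] summands, and the segments themselves
    attain this number.  The claim becomes that the minimum distance is
    [(N - l) * (N - (m + n))].

    Lower bound on weights ([card_torus_nonzeros_ge]).  Slice the torus by the
    value [s] of the second coordinate.  On a slice the polynomial is a
    Laurent polynomial in one variable whose exponents lie in [[- n, m]], so
    it has at most [m + n] zeros there unless it vanishes identically.  Let
    [r] be the number of slices on which it does.  Each coefficient, as a
    polynomial in [s], has [r] roots, so only columns of the hexagon of
    length at least [r] can carry nonzero coefficients.  For [r <= l] the
    number of nonzeros is at least [(N - r) * (N - (m + n))].  For [r = l + j] the surviving columns have
    [j - n <= u <= m - j], and the number is at least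
    [(N - l - j) * (N - (m + n) + 2 * j)]; this is at least
    [(N - l) * (N - (m + n))] as soon as [2 * l + n <= N + m].

    Since [j <= n], the last inequality is used for [n > 0], and there it
    follows from the lower bound on [q] ([box_area_bound]): otherwise the box
    would be so narrow that the direction of the long segments has coordinates
    in [{-1, 0, 1}]; slicing [P] parallel to an axis then gives area at least
    [l / 2], too large for [q].

    Attainment ([zonotope_codeword]).  Let [H] be the subgroup of order [t] of
    the multiplicative group.  Take [A] and [B] inside [H] with [m] and [n]
    elements and [C] containing [H] with [l] elements.  The product of the
    factors [x - a], [s / x - b] and [s - c] is supported in the hexagon.
    Since [A * B] is contained in [C], the zeros of the first two kinds are
    disjoint outside the slices [s \in C], so exactly
    [(N - l) * (N - (m + n))] points are not zeros. *)

Set Implicit Arguments.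
Unset Strict Implicit.
Unset Printing Implicit Defensive.

Import Order.TTheory GRing.Theory Num.Theory.
Import numFieldNormedType.Exports.

Local Open Scope classical_set_scope.
Local Open Scope ring_scope.

(** * Integral charts and the zonotope *)

Lemma det_mx22 (K : comPzRingType) (A : 'M[K]_2) :
  \det A = A 0 0 * A 1 1 - A 0 1 * A 1 0.
Proof.
have i1 : lift 0 0 = 1 :> 'I_2 by apply: val_inj.
have i0 : lift 1 0 = 0 :> 'I_2 by apply: val_inj.
rewrite (expand_det_row A 0) !big_ord_recl big_ord0 /cofactor !det_mx11 !mxE.
by rewrite i1 i0 /= expr0 expr1 mul1r mulN1r addr0 mulrN.
Qed.

Section Chart.

(** An automorphism of the affine lattice, as six integer coefficients.  An
    integer is a unit exactly when its square is 1, so that a single equation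
    covers both orientations and makes the determinant its own inverse. *)
Record chart := Chart {
  c11 : int; c12 : int; c21 : int; c22 : int; c1 : int; c2 : int;
  chart_unimodular : (c11 * c22 - c12 * c21) ^+ 2 = 1 }.

Definition chart_det (c : chart) : int := c11 c * c22 c - c12 c * c21 c.

Definition chart_map (K : pzRingType) (c : chart) (p : K * K) : K * K :=
  ((c11 c)%:~R * p.1 + (c12 c)%:~R * p.2 + (c1 c)%:~R,
   (c21 c)%:~R * p.1 + (c22 c)%:~R * p.2 + (c2 c)%:~R).

(** Cramer's rule, with the determinant in place of its inverse. *)
Definition chart_inv (K : pzRingType) (c : chart) (p : K * K) : K * K :=
  ((chart_det c)%:~R *
     ((c22 c)%:~R * (p.1 - (c1 c)%:~R) - (c12 c)%:~R * (p.2 - (c2 c)%:~R)),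
   (chart_det c)%:~R *
     ((c11 c)%:~R * (p.2 - (c2 c)%:~R) - (c21 c)%:~R * (p.1 - (c1 c)%:~R))).

Lemma chart_detM (K : comPzRingType) c :
  (chart_det c)%:~R * ((c11 c)%:~R * (c22 c)%:~R - (c12 c)%:~R * (c21 c)%:~R)
    = 1 :> K.
Proof.
by rewrite -!intrM -intrB -intrM -[_ * _]/(chart_det c * chart_det c) -expr2
  chart_unimodular.
Qed.

Lemma chart_mapK (K : comPzRingType) c :
  cancel (@chart_map K c) (@chart_inv K c).
Proof.
case=> x y; rewrite /chart_inv /chart_map /=.
move: (chart_detM K c); move: (chart_det c)%:~R (c11 c)%:~R (c12 c)%:~R.
move: (c21 c)%:~R (c22 c)%:~R (c1 c)%:~R (c2 c)%:~R => a b u v D e f E.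
by congr (_, _); rewrite -[RHS]mul1r -E; ring.
Qed.

Lemma chart_invK (K : comPzRingType) c :
  cancel (@chart_inv K c) (@chart_map K c).
Proof.
case=> x y; rewrite /chart_inv /chart_map /=.
move: (chart_detM K c); move: (chart_det c)%:~R (c11 c)%:~R (c12 c)%:~R.
move: (c21 c)%:~R (c22 c)%:~R (c1 c)%:~R (c2 c)%:~R => a b u v D e f E.
congr (_, _); [rewrite -[RHS](subrK u)|rewrite -[RHS](subrK v)];
  by rewrite -[X in _ = X + _]mul1r -E; ring.
Qed.

Lemma chart_map_lattice (R : realType) c a :
  chart_map c (lattice_pt a : R * R) = lattice_pt (chart_map c a).
Proof. by rewrite /chart_map /lattice_pt /= !intz !intrD !intrM. Qed.

(** The zonotope [m[0,e1] + n[0,e2] + l[0,e1+e2]] in the coordinates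
    [(x - y, y)].  The shear turns the direction [e1 + e2] into [(0, 1)], so
    that the long segments become columns. *)
Definition hexagon (K : numDomainType) (m n l : nat) (p : K * K) : bool :=
  [&& 0 <= p.1 + p.2 <= (m + l)%:R, 0 <= p.2 <= (n + l)%:R
    & - n%:R <= p.1 <= m%:R].

Lemma hexagon_lattice (R : realType) m n l a :
  hexagon m n l (lattice_pt a : R * R) = hexagon m n l a.
Proof.
rewrite /hexagon /= !natz.
have e k : k%:R = (k%:Z)%:~R :> R by [].
by rewrite !e -!intrD -!intrN -[0 in LHS]/(0%:~R) !ler_int.
Qed.

End Chart.

Section Zonotope.
Context {R : realType}.
Notation plane := (R * R)%type.

Lemma convex_hull2 (x y : plane) :
  convex_hull [set x; y] = [set x + s *: (y - x) | s in `[0, 1]].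
Proof.
apply/seteqP; split.
  apply: smallest_sub; last first.
    move=> _ [->|->].
      by exists 0; rewrite ?scale0r ?addr0 //= in_itv /= lexx ler01.
    exists 1; first by rewrite /= in_itv /= lexx ler01.
    by rewrite scale1r addrC subrK.
  move=> u v k; rewrite !inE /= => -[s + <-] [t + <-].
  rewrite /= !in_itv /= => /andP[s0 s1] /andP[t0 t1].
  exists (k%:num * s + (1 - k%:num) * t); last first.
    move: (y - x) => d; symmetry.
    transitivity (k%:num *: (x + s *: d) + (1 - k%:num) *: (x + t *: d));
      first by [].
    rewrite !scalerDr addrACA -!scalerDl [k%:num + _]addrC subrK scale1r.
    by rewrite [in RHS]scalerDl !scalerA.
  have k0 : 0 <= k%:num by [].
  have k1 : k%:num <= 1 by [].
  rewrite in_itv /=; apply/andP; split; nra.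
move=> _ [s + <-] M [cM sM].
rewrite /= in_itv /= => /andP[s0 s1].
have := cM y x (Itv01 s0 s1).
rewrite !inE => /(_ (sM _ (or_intror erefl)) (sM _ (or_introl erefl))).
suff -> : conv (Itv01 s0 s1) (y : convex_lmodType _) (x : convex_lmodType _)
   = x + s *: (y - x) by [].
transitivity (s *: y + (1 - s) *: x); first by [].
by rewrite scalerBl scale1r scalerBr addrCA.
Qed.

Lemma segment0E (v : plane) : segment0 v = [set s *: v | s in `[0, 1]].
Proof.
rewrite /segment0 convex_hull2 subr0.
by apply: eq_imagel => s _; rewrite add0r.
Qed.

(** A point satisfying the inequalities is decomposed by choosing the least
    admissible contribution [k] of the diagonal segment; what is left then
    fits into the two other segments. *)
Lemma zonotopeE (m n l : nat) :
  minkowski_sum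
    (minkowski_sum (dilate m%:R (segment0 e1)) (dilate n%:R (segment0 e2)))
    (dilate l%:R (segment0 (e1 + e2)))
  = [set p : plane | hexagon m n l (p.1 - p.2, p.2)].
Proof.
rewrite /minkowski_sum /dilate !segment0E; apply/seteqP; split.
  move=> _ [_ [_ [_ [a + <-] <-]] [_ [_ [b + <-] <-] <-]]
    [_ [_ [c + <-] <-] <-].
  rewrite /= !in_itv /= => /andP[a0 a1] /andP[b0 b1] /andP[c0 c1].
  rewrite /hexagon /= !natrD.
  have : 0 <= m%:R :> R by []. have : 0 <= n%:R :> R by [].
  have : 0 <= l%:R :> R by [].
  move: (m%:R : R) (n%:R : R) (l%:R : R) => M N L L0 N0 M0.
  rewrite /GRing.scale /=.
  apply/and3P; split; apply/andP; split; nra.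
case=> x y; rewrite /hexagon /= !natrD subrK.
have : 0 <= m%:R :> R by []. have : 0 <= n%:R :> R by [].
have : 0 <= l%:R :> R by [].
move: (m%:R : R) (n%:R : R) (l%:R : R) => M N L L0 N0 M0.
move=> /and3P[/andP[h1 h2] /andP[h3 h4] /andP[h5 h6]].
(* A point of a dilated segment, the dilation factor being possibly 0. *)
have sc (r s : R) : 0 <= r -> 0 <= s -> s <= r ->
    exists2 t, t \in `[0, 1] & s = r * t.
  rewrite le_eqVlt => /orP[/eqP<- s0 s1|r0 s0 sr].
    by exists 0; rewrite ?mulr0 ?in_itv /= ?lexx ?ler01 //; lra.
  exists (s / r); last by field; rewrite gt_eqF.
  by rewrite in_itv /= divr_ge0 ?ler_pdivrMr ?mul1r // ltW.
pose k := Num.max 0 (Num.max (x - M) (y - N)).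
have k0 : 0 <= k by rewrite le_max lexx.
have k1 : x - M <= k by rewrite !le_max lexx orbT.
have k2 : y - N <= k by rewrite !le_max lexx !orbT.
have k3 : k <= L by rewrite !ge_max; apply/and3P; split; lra.
have k4 : k <= x by rewrite !ge_max; apply/and3P; split; lra.
have k5 : k <= y by rewrite !ge_max; apply/and3P; split; lra.
have [t tI tE] := sc L k L0 k0 k3.
have [r rI rE] := sc M (x - k) M0 ltac:(lra) ltac:(lra).
have [s sI sE] := sc N (y - k) N0 ltac:(lra) ltac:(lra).
exists (x - k, y - k).
  exists (x - k, 0).
    exists (r *: e1); first by exists r.
    rewrite rE; transitivity ((M * (r * 1), M * (r * 0)) : plane); first by [].
    by rewrite !(mulr0, mulr1).
  exists (0, y - k).
    exists (s *: e2); first by exists s.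
    rewrite sE; transitivity ((N * (s * 0), N * (s * 1)) : plane); first by [].
    by rewrite !(mulr0, mulr1).
  transitivity ((x - k + 0, 0 + (y - k)) : plane); first by [].
  by rewrite add0r addr0.
exists (k, k).
  exists (t *: (e1 + e2)); first by exists t.
  rewrite tE; transitivity ((L * (t * (1 + 0)), L * (t * (0 + 1))) : plane);
    first by [].
  by rewrite addr0 add0r mulr1.
transitivity ((x - k + k, y - k + k) : plane); first by [].
by rewrite !subrK.
Qed.

Lemma lattice_equivalent_chart (P : set plane) (m n l : nat) :
  lattice_equivalent P (minkowski_sum
    (minkowski_sum (dilate m%:R (segment0 e1)) (dilate n%:R (segment0 e2)))
    (dilate l%:R (segment0 (e1 + e2)))) ->
  exists c : chart, P = [set p | hexagon m n l (chart_map c p)].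
Proof.
rewrite zonotopeE => -[A [b [uA PE]]].
have dA : (A 0 0 * A 1 1 - A 0 1 * A 1 0) ^+ 2 = 1.
  move: uA; rewrite unitmxE det_mx22.
  by move=> /orP[]/eqP->.
have dc : ((A 0 0 - A 1 0) * A 1 1 - (A 0 1 - A 1 1) * A 1 0) ^+ 2 = 1.
  by rewrite -dA; ring.
exists (@Chart (A 0 0 - A 1 0) (A 0 1 - A 1 1) (A 1 0) (A 1 1)
  (b.1 - b.2) b.2 dc).
set c := Chart _ _ _.
have TE p : ((affine_map A b p).1 - (affine_map A b p).2, (affine_map A b p).2)
    = chart_map c p.
  by rewrite /affine_map /chart_map /lattice_pt /= !intrB; congr (_, _); ring.
have inj : injective (@affine_map R A b).
  move=> p p' e; apply: (can_inj (@chart_mapK _ c)).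
  by rewrite -!TE e.
apply/seteqP; split=> p /=.
  move=> Pp; rewrite -TE.
  by move: PE => /seteqP[+ _] => /(_ (affine_map A b p)); apply; exists p.
rewrite -TE => h; move: PE => /seteqP[_] => /(_ (affine_map A b p) h).
by case=> p' Pp' /inj <-.
Qed.

End Zonotope.

(** * Area from unit slices *)

Section Area.
Context {R : realType}.
Notation plane := (R * R)%type.
Notation lambda := (@lebesgue_measure R).

Lemma measurable_hexagon (c : chart) (m n l : nat) :
  measurable [set p : plane | hexagon m n l (chart_map c p)].
Proof.
have mt (i j k : int) : measurable_fun [set: plane]
    (fun p : plane => i%:~R * p.1 + j%:~R * p.2 + k%:~R : R).
  apply: measurable_funD => //.
  by apply: measurable_funD; apply: measurable_funM.
have : measurable_fun [set: plane]
    (fun p : plane => hexagon m n l (chart_map c p)).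
  rewrite /hexagon /chart_map /=.
  by do ?[apply: measurable_and | apply: measurable_fun_ler |
          exact: mt | exact: measurable_cst | apply: measurable_funD].
by move=> /(_ measurableT [set true] I); rewrite setTI.
Qed.

Lemma le_lebesgue_itv1 (A : set R) (z : R) : measurable A ->
  (forall w, z <= w <= z + 1 -> A w) -> (1 <= lambda A)%E.
Proof.
move=> mA zA.
apply: (@le_trans _ _ (lambda `[z, z + 1])).
  rewrite lebesgue_measure_itv /= lte_fin ltrDl ltr01.
  by rewrite EFinN -EFinD addrAC subrr add0r.
by apply: le_measure; rewrite ?inE // => w /=; rewrite in_itv /=; exact: zA.
Qed.

Lemma le_integral_itv (f : R -> \bar R) (a d : R) : 0 <= d ->
  measurable_fun setT f -> (forall x, 0 <= f x)%E ->
  (forall x, a <= x <= a + d -> (1 <= f x)%E) ->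
  (d%:E <= \int[lambda]_x f x)%E.
Proof.
move=> d0 mf f0 f1.
pose J : set R := [set` `[a, a + d]].
have mJ : measurable J by exact: measurable_itv.
have lJ : lambda J = d%:E.
  rewrite /J lebesgue_measure_itv /= lte_fin ltrDl.
  case: ltP => d0'; first by rewrite EFinD addeAC subee ?add0e.
  by congr (_%:E); apply/le_anti; rewrite d0 d0'.
apply: (@le_trans _ _ (\int[lambda]_(x in J) f x)%E); last first.
  exact: ge0_subset_integral.
apply: (@le_trans _ _ (\int[lambda]_(x in J) (cst (1%E : \bar R)) x)%E).
  by rewrite integral_cst // mul1e -lJ.
by apply: ge0_le_integral => //; exact: measurable_funTS.
Qed.

(** The slices may drift arbitrarily as [x] varies, so that slanted
    parallelograms can be measured without straightening them. *)
Definition unit_slices (P : set plane) (d : R) : Prop :=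
  exists a, forall x, a <= x <= a + d ->
    exists z, forall w, z <= w <= z + 1 -> P (x, w).

Lemma unit_slices_measure (P : set plane) (d : R) : 0 <= d -> measurable P ->
  unit_slices P d -> (d%:E <= (lambda \x lambda) P)%E.
Proof.
move=> d0 mP [a aP]; apply: (@le_integral_itv _ a) => //.
  exact: measurable_fun_xsection.
move=> x /aP[z zP]; apply: (@le_lebesgue_itv1 _ z).
  exact: measurable_xsection.
by move=> w /zP Pw; apply/xsectionP.
Qed.

(** The other order of integration gives the same product measure. *)
Lemma unit_slices_swap_measure (P : set plane) (d : R) : 0 <= d ->
  measurable P -> unit_slices [set p | P (p.2, p.1)] d ->
  (d%:E <= (lambda \x lambda) P)%E.
Proof.
move=> d0 mP [a aP].
rewrite (product_measure_unique _ (m' := lambda \x^ lambda)%E) //; last first.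
  by move=> A B mA mB; rewrite -product_measure2E.
apply: (@le_integral_itv _ a) => //.
  exact: measurable_fun_ysection.
move=> x /aP[z zP]; apply: (@le_lebesgue_itv1 _ z).
  exact: measurable_ysection.
by move=> w /zP Pw; apply/ysectionP.
Qed.

(** The bounding box makes the measure finite, so that its real value is
    meaningful. *)
Lemma unit_slices_area (P : set plane) (d N : R) : 0 <= d -> measurable P ->
  P `<=` `[0, N] `*` `[0, N] ->
  unit_slices P d \/ unit_slices [set p | P (p.2, p.1)] d ->
  d <= area P.
Proof.
move=> d0 mP PN sl.
have dP : (d%:E <= (lambda \x lambda) P)%E.
  by case: sl; [exact: unit_slices_measure|exact: unit_slices_swap_measure].
have NN : (lambda `[0%R, N] < +oo)%E.
  by rewrite lebesgue_measure_itv /=; case: ifP => _; rewrite -?EFinD ltry.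
have Pfin : ((lambda \x lambda) P < +oo)%E.
  apply: (@le_lt_trans _ _ ((lambda \x lambda)
    (`[0%R, N]%classic `*` `[0%R, N]%classic))%E).
    by apply: le_measure; rewrite ?inE //; exact: measurableX.
  by rewrite product_measure1E // lte_mul_pinfty // ge0_fin_numE.
have Pf : ((lambda \x lambda) P)%E \is a fin_num.
  by rewrite ge0_fin_numE.
by rewrite -lee_fin /area fineK.
Qed.

End Area.

(** * Constraints imposed by the box and the area *)

(** The variation of an affine function over a zonotope is the sum of its
    variations along the generators: it is realised between the two opposite
    vertices that collect the generators on which the linear part is positive,
    respectively negative. *)
Lemma affine_width (A B k N : int) (m n l : nat) :
  (forall p : int * int, hexagon m n l p -> 0 <= A * p.1 + B * p.2 + k <= N) ->
  m%:Z * `|A| + n%:Z * `|B - A| + l%:Z * `|B| <= N.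
Proof.
move=> h.
pose mp : int := if 0 <= A then m%:Z else 0.
pose np : int := if 0 <= B - A then n%:Z else 0.
pose lp : int := if 0 <= B then l%:Z else 0.
have hx (i j o : int) : 0 <= i <= m%:Z -> 0 <= j <= n%:Z -> 0 <= o <= l%:Z ->
    0 <= A * (i - j) + B * (j + o) + k <= N.
  move=> hi hj ho; apply: (h (i - j, j + o)).
  by rewrite /hexagon /= !natz; lia.
have mpP : 0 <= mp <= m%:Z by rewrite /mp; case: ifP; lia.
have npP : 0 <= np <= n%:Z by rewrite /np; case: ifP; lia.
have lpP : 0 <= lp <= l%:Z by rewrite /lp; case: ifP; lia.
have /andP[_ hmax] := hx mp np lp mpP npP lpP.
have /andP[hmin _] := hx (m%:Z - mp) (n%:Z - np) (l%:Z - lp)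
  ltac:(lia) ltac:(lia) ltac:(lia).
(* The two opposite vertices differ by [2 * (mp, np, lp) - (m, n, l)]. *)
have abs (x : int) (s : nat) :
    s%:Z * `|x| = (2 * (if 0 <= x then s%:Z else 0) - s%:Z) * x.
  case: (lerP 0 x) => x0; first by rewrite ger0_norm //; ring.
  by rewrite ltr0_norm //; ring.
rewrite !abs -/mp -/np -/lp; lia.
Qed.

Section Slices.
Context {R : realType}.
Notation plane := (R * R)%type.

(** When the direction of the long segments advances by one unit in the first
    coordinate, a vertical line at abscissa [x] meets the image of the
    parallelogram [0 <= u <= 1], [0 <= w <= l] in a segment on which [u] is a
    coordinate of slope [eta = 1] or [-1]; the slice is thus of length one as
    long as [w] stays in [[0, l]] for every [u], which leaves an interval of
    abscissas of length [l - |A|]. *)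
Lemma parallelogram_unit_slices (A B A' B' : int) (kx ky : R) (m n l : nat)
    (P : set plane) :
  B ^+ 2 = 1 -> (A * B' - B * A') ^+ 2 = 1 -> (0 < m)%N -> (0 < n)%N ->
  (forall u w : R, hexagon m n l (u, w) ->
     P (A%:~R * u + B%:~R * w + kx, A'%:~R * u + B'%:~R * w + ky)) ->
  unit_slices P (l%:R - `|A|%:~R).
Proof.
move=> B2 det2 m0 n0 hP.
have B2R : B%:~R * B%:~R = 1 :> R by rewrite -intrM -expr2 B2.
pose eta := A' - B * B' * A.
have eta2 : eta%:~R * eta%:~R = 1 :> R.
  rewrite -intrM; suff -> : eta * eta = 1 by [].
  have Beta : B * eta = - (A * B' - B * A').
    transitivity (B * A' - B ^+ 2 * (B' * A)); first by rewrite /eta; ring.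
    by rewrite B2; ring.
  transitivity (B ^+ 2 * (eta * eta)); first by rewrite B2 mul1r.
  by transitivity ((B * eta) ^+ 2); [ring|rewrite Beta sqrrN].
have etaR : eta%:~R = A'%:~R - B%:~R * B'%:~R * A%:~R :> R.
  by rewrite /eta intrB !intrM.
have m1 : 1 <= m%:R :> R by rewrite ler1n.
have n1 : 1 <= n%:R :> R by rewrite ler1n.
(* The abscissas start at [w = 0] or at [w = l], according to the sign of
   [B]. *)
pose b0 : R := if 0 <= B then 0 else - l%:R.
exists (kx + Num.max 0 A%:~R + b0) => x hx.
pose z0 : R := ky + B'%:~R * B%:~R * (x - kx).
exists (z0 + Num.min 0 eta%:~R) => y hy.
pose u : R := eta%:~R * (y - z0).
pose w : R := B%:~R * (x - kx - A%:~R * u).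
have -> : x = A%:~R * u + B%:~R * w + kx.
  by rewrite /w [B%:~R * (B%:~R * _)]mulrA B2R; ring.
have -> : y = A'%:~R * u + B'%:~R * w + ky.
  have -> : A'%:~R * u + B'%:~R * w + ky = eta%:~R * u + z0.
    by rewrite etaR /w /z0; ring.
  by rewrite /u [eta%:~R * (eta%:~R * _)]mulrA eta2; ring.
apply: hP.
have u01 : 0 <= u <= 1.
  have /orP[/eqP e|/eqP e] : (eta%:~R == 1 :> R) || (eta%:~R == -1 :> R).
  - by rewrite -sqrf_eq1 expr2 eta2.
  - by move: hy; rewrite /u e min_l ?ler01 //; lra.
  - by move: hy; rewrite /u e min_r ?lerN10 //; lra.
have wl : 0 <= w <= l%:R.
  move: hx; rewrite /w /b0 intr_norm.
  have Bpm : (B == 1) || (B == -1) by rewrite -sqrf_eq1 B2.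
  case: (lerP 0 A) => A0.
    have A0R : 0 <= A%:~R :> R by rewrite ler0z.
    have Au : 0 <= A%:~R * u <= A%:~R by nra.
    rewrite (max_r A0R) (ger0_norm A0R).
    by case/orP: Bpm => /eqP ->; rewrite ?ler01 ?lerN10 /=; lra.
  have A0R : A%:~R <= 0 :> R by rewrite lerz0 ltW.
  have Au : A%:~R <= A%:~R * u <= 0 by nra.
  rewrite (max_l A0R) (ler0_norm A0R).
  by case/orP: Bpm => /eqP ->; rewrite ?ler01 ?lerN10 /=; lra.
rewrite /hexagon /= !natrD; lra.
Qed.

End Slices.

(** Here [S] stands for the square root of the field size [Q] and [a] for the
    area: [M >= 6] forces [S >= 6], and then [M >= 2 * a - 1] with
    [a >= Q / 4] makes [M * S] exceed [Q]. *)
Lemma large_field_contradiction (R : realFieldType) (Q L M S a : R) :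
  a < Q - 1 - M * S -> 2 * a - 1 <= M -> 6 <= M ->
  S ^+ 2 = Q -> Q <= 2 * L -> 0 <= S -> L / 2 <= a -> False.
Proof.
move=> h M1 M2 S2 QL S0 La.
have a4 : Q / 4 <= a by lra.
have h6 : 6 * S <= M * S by rewrite ler_wpM2r.
have hA : (2 * a - 1) * S <= M * S by rewrite ler_wpM2r.
have S6 : 6 <= S by nra.
have : (Q / 2 - 1) * S <= (2 * a - 1) * S by rewrite ler_wpM2r //; lra.
have : (Q / 2 - 1) * 6 <= (Q / 2 - 1) * S by rewrite ler_wpM2l //; nra.
nra.
Qed.

Section Box.
Context {R : realType} (c : chart) (m n l q : nat).
Notation plane := (R * R)%type.
Let P : set plane := [set p | hexagon m n l (chart_map c p)].
Hypothesis Pbox : P `<=` `[0, q%:R - 2] `*` `[0, q%:R - 2].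
Hypotheses (nm : (n <= m)%N) (ml : (m <= l)%N).

(* The inverse chart sends [(u, w)] to
   [(A * u + B * w + _, A' * u + B' * w + _)]. *)
Let A := chart_det c * c22 c.
Let B := - (chart_det c * c12 c).
Let A' := - (chart_det c * c21 c).
Let B' := chart_det c * c11 c.

Let chart_invE (K : comPzRingType) (p : K * K) : chart_inv c p =
  (A%:~R * p.1 + B%:~R * p.2 + (chart_inv c (0 : K * K)).1,
   A'%:~R * p.1 + B'%:~R * p.2 + (chart_inv c (0 : K * K)).2).
Proof.
rewrite /chart_inv /A /B /A' /B' /= !intrN !intrM.
by congr (_, _); ring.
Qed.

Let det2 : (A * B' - B * A') ^+ 2 = 1.
Proof.
have e : (chart_det c) ^+ 2 = 1 := chart_unimodular c.
transitivity (((chart_det c) ^+ 2) ^+ 3); last by rewrite e expr1n.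
rewrite /A /B /A' /B'.
transitivity ((chart_det c ^+ 2 * (c11 c * c22 c - c12 c * c21 c)) ^+ 2).
  by ring.
by rewrite -[c11 c * _ - _]/(chart_det c); ring.
Qed.

Let lattice_box (p : int * int) : hexagon m n l p ->
  (0 <= (chart_inv c p).1 <= q%:Z - 2) && (0 <= (chart_inv c p).2 <= q%:Z - 2).
Proof.
move=> hp; have /Pbox : P (lattice_pt (chart_inv c p)).
  by rewrite /P /= chart_map_lattice chart_invK hexagon_lattice.
case; rewrite /= !in_itv /=.
have -> : q%:R - 2 = (q%:Z - 2)%:~R :> R by rewrite intrB.
by rewrite -[0]/(0%:~R) !ler_int => -> ->.
Qed.

Let width1 : m%:Z * `|A| + n%:Z * `|B - A| + l%:Z * `|B| <= q%:Z - 2.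
Proof.
apply: (@affine_width _ _ (chart_inv c (0 : int * int)).1) => p.
by move/lattice_box => /andP[+ _]; rewrite chart_invE !intz.
Qed.

Let width2 : m%:Z * `|A'| + n%:Z * `|B' - A'| + l%:Z * `|B'| <= q%:Z - 2.
Proof.
apply: (@affine_width _ _ (chart_inv c (0 : int * int)).2) => p.
by move/lattice_box => /andP[_ +]; rewrite chart_invE !intz.
Qed.

(* [(B, B')] is the direction of the long segments in the original plane. *)
Let B_neq0 : (B != 0) || (B' != 0).
Proof.
apply/negPn; rewrite negb_or !negbK; apply/negP => /andP[/eqP b0 /eqP b'0].
by move: det2; rewrite b0 b'0 mulr0 mul0r subrr expr0n.
Qed.

(** One of the two coordinates is not constant along the long segments, and
    then it also varies along one of the two other kinds of segments. *)
Lemma box_zonotope_width : (n + l + 2 <= q)%N.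
Proof.
suff: n%:Z + l%:Z <= q%:Z - 2 by lia.
have key (a b : int) : b != 0 ->
    m%:Z * `|a| + n%:Z * `|b - a| + l%:Z * `|b| <= q%:Z - 2 ->
    n%:Z + l%:Z <= q%:Z - 2.
  move=> b0; apply: le_trans.
  have h1 : 1 <= `|b| by rewrite -gtz0_ge1 normr_gt0.
  have h2 : 1 <= `|a| + `|b - a| by lia.
  have e1 : n%:Z * `|a| <= m%:Z * `|a| by rewrite ler_wpM2r.
  have e2 : n%:Z <= n%:Z * (`|a| + `|b - a|) by rewrite ler_peMr.
  have e3 : l%:Z <= l%:Z * `|b| by rewrite ler_peMr.
  by rewrite mulrDr in e2; lra.
by case/orP: B_neq0 => b0; [exact: key width1|exact: key width2].
Qed.

(** In so small a box the long segments can advance by at most one unit in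
    each coordinate.  In a coordinate where they do advance they take up [l]
    of the fewer than [2 * l] units available.  What remains is shared by the
    two other directions, whose coordinates [A] and [B - A] add up to 1 or
    [-1] and so are nearly opposite: this gives [|A| <= l / 2]. *)
Lemma box_area : (0 < n)%N -> (q + m <= n + l + l)%N ->
  l%:R / 2 <= area P.
Proof.
move=> n0 qsmall; have m0 : (0 < m)%N by lia.
have ql : q%:Z <= l%:Z * 2 by lia.
have B01 (a b : int) :
    m%:Z * `|a| + n%:Z * `|b - a| + l%:Z * `|b| <= q%:Z - 2 ->
    b != 0 -> b ^+ 2 = 1 /\ 2 * `|a| <= l%:Z.
  move=> w b0; have h1 : 1 <= `|b| by rewrite -gtz0_ge1 normr_gt0.
  have e1 : `|a| <= m%:Z * `|a| by rewrite ler_peMl //; lia.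
  have e2 : `|b - a| <= n%:Z * `|b - a| by rewrite ler_peMl //; lia.
  have hb : `|b| = 1.
    apply/eqP; rewrite eq_le h1 andbT leNgt; apply/negP => b2.
    have b2' : 2 <= `|b| by rewrite -lez1D in b2.
    have : l%:Z * 2 <= l%:Z * `|b| by rewrite ler_wpM2l.
    have := normr_ge0 a; have := normr_ge0 (b - a); lra.
  have {e1 e2}w' : `|a| + `|b - a| <= l%:Z - 2 by rewrite hb in w; lra.
  split; first by rewrite -real_normK ?num_real // hb.
  by move: w' hb; clear; lia.
have half (a : int) : 2 * `|a| <= l%:Z -> l%:R / 2 <= l%:R - `|a|%:~R :> R.
  by rewrite -(ler_int R) intrM -[l%:~R]/(l%:R : R) => h; lra.
have slices_area (a : int) : 2 * `|a| <= l%:Z ->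
    unit_slices P (l%:R - `|a|%:~R) \/
      unit_slices [set p | P (p.2, p.1)] (l%:R - `|a|%:~R) ->
    l%:R / 2 <= area P.
  move=> ha sl; apply: le_trans (half _ ha) _.
  apply: unit_slices_area Pbox sl; last exact: measurable_hexagon.
  by apply: le_trans (half _ ha); rewrite divr_ge0.
have Pinv (u w : R) : hexagon m n l (u, w) -> P (chart_inv c (u, w)).
  by move=> h; rewrite /P /= chart_invK.
case/orP: B_neq0 => b0.
  have [B2 Al] := B01 _ _ width1 b0; apply: (slices_area _ Al); left.
  apply: (parallelogram_unit_slices (kx := (chart_inv c 0).1)
    (ky := (chart_inv c 0).2) B2 det2 m0 n0) => u w /Pinv.
  by rewrite chart_invE.
have [B2 Al] := B01 _ _ width2 b0; apply: (slices_area _ Al); right.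
have det2' : (A' * B - B' * A) ^+ 2 = 1 by rewrite -det2; ring.
apply: (parallelogram_unit_slices (kx := (chart_inv c 0).2)
  (ky := (chart_inv c 0).1) B2 det2' m0 n0) => u w /Pinv.
by rewrite chart_invE.
Qed.

Lemma box_area_bound :
  area P < q%:R - 1 - Num.max (2 * area P - 1) 6 * Num.sqrt q%:R ->
  (0 < n)%N -> (2 * l + n < q + m)%N.
Proof.
move=> hlarge n0; rewrite ltnNge; apply/negP => qsmall.
have := box_area n0 ltac:(lia).
have q0 : 0 <= Num.sqrt (q%:R : R) by exact: sqrtr_ge0.
have q2 : Num.sqrt (q%:R : R) ^+ 2 = q%:R by rewrite sqr_sqrtr.
have ql : q%:R <= 2 * l%:R :> R by rewrite -natrM ler_nat; lia.
have mx1 : 2 * area P - 1 <= Num.max (2 * area P - 1) 6 by rewrite le_max lexx.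
have mx2 : 6 <= Num.max (2 * area P - 1) 6 by rewrite le_max lexx orbT.
exact: large_field_contradiction hlarge mx1 mx2 q2 ql q0.
Qed.

End Box.

(** * The Minkowski length *)

Section MinkowskiLength.
Context {R : realType}.
Notation plane := (R * R)%type.

Lemma lattice_polytope_segment (a b : int * int) : a != b ->
  let Q := convex_hull [set lattice_pt a; lattice_pt b : plane] in
  lattice_polytope Q /\ nontrivial Q.
Proof.
move=> ab Q; split.
  exists [:: a; b]; split => //; congr convex_hull.
  apply/seteqP; split => [_ [->|->]|_ [x + <-]].
  - by exists a => //=; rewrite inE eqxx.
  - by exists b => //=; rewrite !inE eqxx orbT.
  - by rewrite /= !inE => /orP[/eqP->|/eqP->]; [left|right].
exists (lattice_pt a), (lattice_pt b); split.
- by apply: sub_gen_smallest; left.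
- by apply: sub_gen_smallest; right.
- case: a b ab {Q} => a1 a2 [b1 b2] /eqP ab [] /eqP + /eqP.
  by rewrite !eqr_int => /eqP e1 /eqP e2; apply: ab; rewrite e1 e2.
Qed.

(** If all the generating lattice points coincided, the hull would be a
    point. *)
Lemma nontrivial_lattice_points (Q : set plane) :
  lattice_polytope Q -> nontrivial Q ->
  exists a b : int * int, [/\ a != b, Q (lattice_pt a) & Q (lattice_pt b)].
Proof.
case=> -[|a s] [sn QE] [x [y [Qx Qy xy]]].
  by case: sn.
have Qs b : b \in a :: s -> Q (lattice_pt b).
  by move=> bs; rewrite QE; apply: sub_gen_smallest; exists b.
have [/allP h|/allPn[b bs ba]] := boolP (all (pred1 a) s); last first.
  exists a, b; split; rewrite 1?eq_sym //; apply: Qs; rewrite inE ?eqxx //.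
  by rewrite bs orbT.
exfalso; apply: xy.
suff sub : Q `<=` [set lattice_pt a] by rewrite (sub _ Qx) (sub _ Qy).
rewrite QE; apply: smallest_sub.
  by move=> u v k; rewrite !inE /= => -> ->; rewrite convmm.
move=> _ [b + <-]; rewrite /= inE => /orP[/eqP -> //|/h /= /eqP -> //].
Qed.

Lemma minkowski_sum_bigP (k : nat) (Q : 'I_k -> set plane) (z : plane) :
  (\big[minkowski_sum/[set 0]]_(i < k) Q i) z <->
  exists x : 'I_k -> plane, (forall i, Q i (x i)) /\ \sum_i x i = z.
Proof.
split=> [|[x [Qx <-]]]; last first.
  apply: (big_ind2 (fun (A : set plane) (v : plane) => A v)) => //.
  by move=> A u B v Au Bv; exists u => //; exists v.
elim: k Q z => [|k IH] Q z.
  rewrite big_ord0 => ->; exists (fun _ => 0).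
  by split; [case|rewrite big_ord0].
rewrite big_ord_recl => -[u Qu [v /IH[x [Qx <-]] <-]].
exists (fun i => if unlift ord0 i is Some j then x j else u); split.
  by move=> i; case: unliftP => [j|] ->.
rewrite big_ord_recl unlift_none; congr (_ + _).
by apply: eq_bigr => i _; rewrite liftK.
Qed.

(** Choosing in every pair the point with the larger, respectively the
    smaller, value of a linear form gives two points of the Minkowski sum
    whose values differ by the sum of all the individual differences. *)
Lemma sum_width (k : nat) (a b : 'I_k -> int * int) (r s lo w : int) :
  (forall t : 'I_k -> bool, let p := \sum_i (if t i then a i else b i) in
     lo <= r * p.1 + s * p.2 <= lo + w) ->
  \sum_i `|r * ((a i).1 - (b i).1) + s * ((a i).2 - (b i).2)| <= w.
Proof.
move=> h.
pose f (p : int * int) := r * p.1 + s * p.2.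
have fD : {morph f : p p' / p + p'} by move=> p p'; rewrite /f /=; ring.
have f0 : f 0 = 0 by rewrite /f /= !mulr0.
have fsum (F : 'I_k -> int * int) : f (\sum_i F i) = \sum_i f (F i).
  exact: (big_morph f fD f0).
pose t i := f (b i) <= f (a i).
have /andP[_ h1] := h t.
have /andP[h2 _] := h (fun i => ~~ t i).
suff -> : \sum_i `|r * ((a i).1 - (b i).1) + s * ((a i).2 - (b i).2)| =
    f (\sum_i (if t i then a i else b i)) -
    f (\sum_i (if ~~ t i then a i else b i)).
  by apply: le_trans (lerB h1 h2) _; rewrite addrAC subrr add0r.
rewrite !fsum -sumrB; apply: eq_bigr => i _.
have -> : r * ((a i).1 - (b i).1) + s * ((a i).2 - (b i).2) = f (a i) - f (b i).
  by rewrite /f; ring.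
by rewrite /t; case: lerP.
Qed.

Variables (c : chart) (m n l : nat).
Let P : set plane := [set p | hexagon m n l (chart_map c p)].

(** The forms [u], [w] and [u + w] satisfy [|u| + |w| + |u + w| >= 2] at every
    nonzero lattice vector, while their widths on the hexagon sum to
    [2 * (m + n + l)]. *)
Lemma minkowski_length_ub (k : nat) (Q : 'I_k -> set plane) :
  (forall i, lattice_polytope (Q i) /\ nontrivial (Q i)) ->
  \big[minkowski_sum/[set 0]]_(i < k) Q i `<=` P ->
  (k <= m + n + l)%N.
Proof.
move=> hQ sub.
have /choice[ab abP] : forall i, exists ab : (int * int) * (int * int),
    [/\ ab.1 != ab.2, Q i (lattice_pt ab.1) & Q i (lattice_pt ab.2)].
  move=> i; have [hL hN] := hQ i.
  by have [a [b ?]] := nontrivial_lattice_points hL hN; exists (a, b).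
pose a i := (ab i).1; pose b i := (ab i).2.
have hex (t : 'I_k -> bool) :
    hexagon m n l (chart_map c (\sum_i (if t i then a i else b i))).
  rewrite -(@hexagon_lattice R) -chart_map_lattice; apply: sub.
  apply/minkowski_sum_bigP.
  exists (fun i => lattice_pt (if t i then a i else b i)); split.
    by move=> i; have [_ ha hb] := abP i; case: (t i).
  symmetry; apply: (big_morph (@lattice_pt R)) => [x y|];
    last by rewrite /lattice_pt.
  by rewrite /lattice_pt /= !intrD.
pose x i := c11 c * ((a i).1 - (b i).1) + c12 c * ((a i).2 - (b i).2).
pose y i := c21 c * ((a i).1 - (b i).1) + c22 c * ((a i).2 - (b i).2).
have w1 : \sum_i `|x i| <= m%:Z + n%:Z.
  apply: (@sum_width _ _ _ _ _ (- n%:Z - c1 c)) => t /=.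
  by have := hex t; rewrite /hexagon /chart_map /= !intz !natz; lia.
have w2 : \sum_i `|y i| <= n%:Z + l%:Z.
  apply: (@sum_width _ _ _ _ _ (- c2 c)) => t /=.
  by have := hex t; rewrite /hexagon /chart_map /= !intz !natz; lia.
have w3 : \sum_i `|x i + y i| <= m%:Z + l%:Z.
  have -> : \sum_i `|x i + y i| =
      \sum_i `|(c11 c + c21 c) * ((a i).1 - (b i).1) +
        (c12 c + c22 c) * ((a i).2 - (b i).2)|.
    by apply: eq_bigr => i _; rewrite /x /y; congr (`|_|); ring.
  apply: (@sum_width _ _ _ _ _ (- c1 c - c2 c)) => t /=.
  rewrite !mulrDl.
  by have := hex t; rewrite /hexagon /chart_map /= !intz !natz; lia.
have xy i : 2 <= `|x i| + `|y i| + `|x i + y i|.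
  have [x0|x0] := eqVneq (x i) 0; last by lia.
  have [y0|y0] := eqVneq (y i) 0; last by lia.
  have [/eqP ne _ _] := abP i; exfalso; apply: ne.
  apply: (can_inj (@chart_mapK _ c)).
  move: x0 y0; rewrite /x /y /chart_map !intz -/(a i) -/(b i) => x0 y0.
  by congr (_, _); lra.
have : 2 * k%:Z <= m%:Z + n%:Z + (n%:Z + l%:Z) + (m%:Z + l%:Z).
  apply: le_trans (lerD (lerD w1 w2) w3); rewrite -!big_split /=.
  rewrite -[k in leLHS]card_ord -natz mulr_natr -sumr_const.
  exact: ler_sum.
lia.
Qed.

(** The summands are the unit segments along the generators; one of them is
    translated, so that the sum starts at the vertex of [P] that the chart
    sends to the origin.  There is no summand to translate when
    [m + n + l = 0]. *)
Lemma minkowski_length_attained : (0 < m + n + l)%N ->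
  exists Q : 'I_(m + n + l) -> set plane,
    (forall i, lattice_polytope (Q i) /\ nontrivial (Q i)) /\
    \big[minkowski_sum/[set 0]]_(i < m + n + l) Q i `<=` P.
Proof.
set k := (m + n + l)%N => k0.
pose g (i : 'I_k) : int * int :=
  if (i < m)%N then (1, 0) else if (i < m + n)%N then (-1, 1) else (0, 1).
pose o : int * int := chart_inv c 0.
pose off (i : 'I_k) := if i == Ordinal k0 then o else 0.
pose dir (i : 'I_k) := chart_inv c (g i) - o.
have dir0 i : off i != off i + dir i.
  rewrite -[X in X != _]addr0 (inj_eq (addrI (off i))) eq_sym /dir subr_eq0.
  have inj : injective (@chart_inv int c) by exact: can_inj (@chart_invK _ c).
  apply/eqP => /inj.
  by rewrite /g; case: ifP => _ //; case: ifP.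
exists (fun i =>
  convex_hull [set lattice_pt (off i); lattice_pt (off i + dir i)]).
split=> [i|z /minkowski_sum_bigP[x [hx <-]]].
  exact: lattice_polytope_segment (dir0 i).
have /choice[s sP] : forall i, exists s : R, 0 <= s <= 1 /\
    x i = lattice_pt (off i) + s *: lattice_pt (dir i).
  move=> i; have := hx i; rewrite convex_hull2 => -[s + <-].
  rewrite /= in_itv /= => s01; exists s; split=> //; congr (_ + _ *: _).
  by rewrite /lattice_pt /= !intrD; congr (_, _); rewrite addrC addKr.
have -> : \sum_i x i = lattice_pt o + \sum_i s i *: lattice_pt (dir i).
  rewrite (eq_bigr _ (fun i _ => (sP i).2)) big_split /=; congr (_ + _).
  rewrite (bigD1 (Ordinal k0)) //= /off eqxx big1 ?addr0 // => i /negbTE ->.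
  by [].
pose X := \sum_(i < m) s (lshift l (lshift n i)).
pose Y := \sum_(i < n) s (lshift l (rshift m i)).
pose Z := \sum_(i < l) s (rshift (m + n) i).
have sum01 (p : nat) (f : 'I_p -> 'I_k) : 0 <= \sum_i s (f i) <= p%:R.
  apply/andP; split.
    by apply: sumr_ge0 => i _; have [/andP[]] := sP (f i).
  rewrite -[p in leRHS]card_ord -sumr_const.
  by apply: ler_sum => i _; have [/andP[]] := sP (f i).
have /andP[X0 X1] : 0 <= X <= m%:R := sum01 _ (fun i => lshift l (lshift n i)).
have /andP[Y0 Y1] : 0 <= Y <= n%:R := sum01 _ (fun i => lshift l (rshift m i)).
have /andP[Z0 Z1] : 0 <= Z <= l%:R := sum01 _ (fun i => rshift (m + n) i).
suff zE : chart_map c (lattice_pt o + \sum_i s i *: lattice_pt (dir i)) =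
    (X - Y, Y + Z).
  by rewrite /P /= zE /hexagon /= !natrD; lra.
pose L (v : plane) : plane :=
  ((c11 c)%:~R * v.1 + (c12 c)%:~R * v.2,
   (c21 c)%:~R * v.1 + (c22 c)%:~R * v.2).
have LD : {morph L : u v / u + v}.
  by case=> u1 u2 [v1 v2]; rewrite /L /=; congr (_, _) => /=; ring.
have L0 : L 0 = 0 by rewrite /L /= !mulr0 addr0.
have LZ a v : L (a *: v) = a *: L v.
  case: v => v1 v2; rewrite /L /=.
  by transitivity ((a * ((c11 c)%:~R * v1 + (c12 c)%:~R * v2),
    a * ((c21 c)%:~R * v1 + (c22 c)%:~R * v2)) : plane) => //; congr (_, _);
    rewrite /GRing.scale /=; ring.
have chartD u v : chart_map c (u + v) = chart_map c u + L v.
  by case: u v => u1 u2 [v1 v2]; rewrite /L /chart_map /=;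
    congr (_, _) => /=; ring.
have oE : chart_map c (lattice_pt o : plane) = 0.
  by rewrite chart_map_lattice /o chart_invK.
have Ldir i : L (lattice_pt (dir i)) = lattice_pt (g i).
  rewrite -[LHS]add0r -[X in X + _]oE -chartD.
  have -> : lattice_pt o + lattice_pt (dir i) =
      lattice_pt (chart_inv c (g i)) :> plane.
    rewrite /dir /lattice_pt /= !intrB.
    by congr (_, _) => /=; rewrite addrC subrK.
  by rewrite chart_map_lattice chart_invK.
rewrite chartD oE add0r (big_morph L LD L0).
under eq_bigr => i _ do rewrite LZ Ldir.
rewrite big_split_ord big_split_ord /=.
under eq_bigr => i _.
  have -> : g (lshift l (lshift n i)) = (1, 0) by rewrite /g /= ltn_ord.
  over.
rewrite -scaler_suml -/X.
under eq_bigr => i _.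
  have -> : g (lshift l (rshift m i)) = (-1, 1).
    by rewrite /g /= ltn_add2l ltn_ord ltnNge leq_addr.
  over.
rewrite -scaler_suml -/Y.
under eq_bigr => i _.
  have -> : g (rshift (m + n) i) = (0, 1).
    by rewrite /g /= !ltnNge leq_addr -addnA leq_addr.
  over.
rewrite -scaler_suml -/Z.
transitivity ((X * 1%:~R + Y * (-1)%:~R + Z * 0%:~R,
  X * 0%:~R + Y * 1%:~R + Z * 1%:~R) : plane); first by [].
by congr (_, _); ring.
Qed.

Lemma minkowski_lengthE : minkowski_length P = (m + n + l)%N.
Proof.
(* When [m + n + l = 0] the set of admissible lengths may be empty, and the
   default value 0 of the supremum is the right one. *)
rewrite /minkowski_length; set S := [set k | _].
have ubS k : S k -> (k <= m + n + l)%N.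
  by case=> Q [hQ sub]; exact: minkowski_length_ub hQ sub.
have topS : (0 < m + n + l)%N -> S (m + n + l)%N.
  by move=> /minkowski_length_attained.
apply/eqP; rewrite eqn_leq; apply/andP; split.
  rewrite /supremum; case: ifPn => // /set0P[k0 Sk0].
  case: xgetP => [y -> [_ lby]|none]; last by [].
  by apply: lby => k /ubS.
case: (posnP (m + n + l)) => [->//|/topS top].
apply: ge_supremum_Nmem top; apply: nat_supremums_neq0.
by exists (m + n + l)%N => k /ubS.
Qed.

End MinkowskiLength.

(** * Zeros of Laurent polynomials supported in the hexagon *)

Section UnitRoots.
Local Open Scope set_scope.
Variable F : finFieldType.
Notation N := #|{: {unit F}}|.

Lemma unit_neq0 (x : {unit F}) : val x != 0.
Proof. by rewrite -unitfE (valP x). Qed.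

(** After division by a power of the variable, which is invertible, the sum is
    a nonzero polynomial of degree at most [d]. *)
Lemma card_laurent_zeros (K : nat) (p : 'I_K -> F) (a : int) (lo d : nat) :
  (forall i, p i != 0 -> (lo <= i <= lo + d)%N) -> (exists i, p i != 0) ->
  (#|[set x : {unit F} | (\sum_(i < K) p i * val x ^ (a + i%:Z) == 0)%R]|
    <= d)%N.
Proof.
move=> hlo [i0 pi0].
have hi0 := hlo _ pi0.
pose Q := \poly_(k < d.+1) (if insub (lo + k)%N is Some i then p i else 0).
have QE x : \sum_(i < K) p i * val x ^ (a + i%:Z) =
    val x ^ (a + lo%:Z) * Q.[val (x : {unit F})].
  have x0 := unit_neq0 x.
  rewrite horner_poly mulr_sumr.
  transitivity (\sum_(i < K) \sum_(k < d.+1 | (lo + k)%N == i)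
      p i * val x ^ (a + i%:Z)).
    apply: eq_bigr => i _; have [->|pi] := eqVneq (p i) 0.
      by rewrite big1 => [|k _]; rewrite mul0r.
    have /andP[i1 i2] := hlo _ pi.
    have kd : (i - lo < d.+1)%N by rewrite ltnS leq_subLR.
    rewrite (big_pred1 (Ordinal kd)) // => k /=.
    by apply/eqP/eqP => [e|->] /=; [apply: val_inj => /=; lia|lia].
  rewrite (exchange_big_dep xpredT) //=; apply: eq_bigr => k _.
  case: insubP => [i _ iE|]; last first.
    rewrite -leqNgt => Kk; rewrite mul0r mulr0 big_pred0 // => i.
    by apply/negbTE; rewrite neq_ltn (leq_trans (ltn_ord i) Kk) orbT.
  rewrite (big_pred1 i) => [|j]; last by rewrite -iE eq_sym val_eqE.
  by rewrite iE PoszD addrA expfzDr // mulrCA mulrA.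
have Q0 : Q != 0.
  have kd : (i0 - lo < d.+1)%N by rewrite ltnS leq_subLR; case/andP: hi0.
  apply/eqP => /polyP /(_ (i0 - lo)%N); rewrite coef_poly kd coef0 subnKC;
    last by case/andP: hi0.
  rewrite insubT //= => ip; apply/eqP.
  by rewrite [Sub _ _](_ : _ = i0) //; exact: val_inj.
set Z := [set x | _].
rewrite cardE -(size_map val) -ltnS.
apply: leq_trans (size_poly d.+1 _); apply: (max_poly_roots Q0).
  apply/allP => _ /mapP[x + ->]; rewrite mem_enum /Z inE QE mulf_eq0 expfz_eq0.
  by rewrite (negbTE (unit_neq0 x)) andbF.
by rewrite map_inj_uniq ?enum_uniq //; exact: val_inj.
Qed.

(** The value at a torus point of a Laurent polynomial supported in the
    hexagon, summed column by column over a rectangle that contains it. *)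
Definition window_eval (m n l : nat) (C : int * int -> F)
    (x s : {unit F}) : F :=
  \sum_(i < (m + n).+1) \sum_(k < (n + l).+1)
    C (i%:Z - n%:Z, k%:Z) * (val x ^ (i%:Z - n%:Z) * val s ^ k%:Z).

Lemma card_torus_fibers (b : {unit F} -> {unit F} -> bool) :
  #|[set h : torus F | b h.1 h.2]| = (\sum_s #|[set x | b x s]|)%N.
Proof.
transitivity (\sum_s \sum_(x | b x s) 1)%N; last first.
  apply: eq_bigr => s _; rewrite -sum1_card.
  by apply: eq_bigl => x; rewrite inE.
rewrite (exchange_big_dep xpredT) //= -sum1_card.
by rewrite pair_big_dep /=; apply: eq_bigl => h; rewrite inE.
Qed.

(** The trade-off between slices on which the polynomial vanishes identically
    and the degree left on the other slices: [j] vanishing slices beyond [l]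
    rule out the columns shorter than [l + j], hence remove [2 * j] from the
    degree. *)
Lemma card_torus_nonzeros_ge (m n l : nat) (C : int * int -> F) :
  (n <= m)%N -> (n + l < N)%N -> ((0 < n)%N -> (2 * l + n <= N + m)%N) ->
  (forall p, C p != 0 -> hexagon m n l p) -> (exists p, C p != 0) ->
  ((N - l) * (N - (m + n)) <= #|[set h : torus F |
    window_eval m n l C h.1 h.2 != 0%R]|)%N.
Proof.
move=> nm nlN lN hC [p0 Cp0].
pose col (i : 'I_(m + n).+1) (s : {unit F}) : F :=
  \sum_(k < (n + l).+1) C (i%:Z - n%:Z, k%:Z) * val s ^ (0 + k%:Z).
have idx p : C p != 0 -> exists (i : 'I_(m + n).+1) (k : 'I_(n + l).+1),
    p = (i%:Z - n%:Z, k%:Z).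
  move=> /hC; case: p => u y; rewrite /hexagon /= !natz => h.
  have hi : (absz (u + n%:Z)%R < (m + n).+1)%N by lia.
  have hk : (absz y < (n + l).+1)%N by lia.
  by exists (Ordinal hi), (Ordinal hk); congr (_, _) => /=; lia.
pose Z := [set s | [forall i, col i s == 0]].
pose r := #|Z|; pose j := (r - l)%N.
(* Column [u = i - n] of the hexagon runs from [max 0 (- u)] to
   [min (n + l) (m + l - u)], and its coefficient has the [r] elements of [Z]
   among its roots. *)
have colZ (i : 'I_(m + n).+1) (k : 'I_(n + l).+1) :
    C (i%:Z - n%:Z, k%:Z) != 0 -> (j <= i <= m + n - j)%N && (j <= n)%N.
  move=> Cik; have := hC _ Cik; rewrite /hexagon /= !natz => hik.
  pose lo := (n - i)%N; pose d := (minn (n + l) (m + l + n - i) - lo)%N.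
  have rd : (r <= d)%N.
    apply: leq_trans (@card_laurent_zeros _
      (fun k : 'I_(n + l).+1 => C (i%:Z - n%:Z, k%:Z)) 0 lo d _ _).
    - apply/subset_leq_card/fintype.subsetP => s; rewrite !inE.
      by move=> /forallP /(_ i).
    - move=> k' /hC; rewrite /hexagon /= !natz /lo /d; lia.
    - by exists k.
  move: rd; rewrite /d /lo /j; lia.
have [i0 [k0 p0E]] := idx _ Cp0.
have jn : (j <= n)%N by rewrite p0E in Cp0; have /andP[] := colZ _ _ Cp0.
rewrite (card_torus_fibers (fun x s => window_eval m n l C x s != 0)).
have fiber (s : {unit F}) : s \notin Z ->
    (N - (m + n - j - j) <= #|[set x : {unit F} |
    window_eval m n l C x s != 0%R]|)%N.
  rewrite inE negb_forall => /existsP[i1 coli1].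
  rewrite leq_subLR -(cardsC [set x : {unit F} | (\sum_(i < (m + n).+1)
    col i s * val x ^ (- n%:Z + i%:Z) == 0)%R]).
  apply: leq_add; last first.
    apply/eq_leq/eq_card => x; rewrite !inE /window_eval; congr (_ != _).
    apply: eq_bigr => i _; rewrite /col mulr_suml; apply: eq_bigr => k _.
    by rewrite add0r [- _ + _]addrC -mulrA [X in _ * X]mulrC.
  apply: (@card_laurent_zeros _ (col^~ s) _ j); last by exists i1.
  move=> i; apply: contraR => hi; rewrite /col big1 // => k _.
  have [->|/colZ] := eqVneq (C (i%:Z - n%:Z, k%:Z)) 0; first by rewrite mul0r.
  by move: hi; lia.
apply: (@leq_trans (\sum_(s in ~: Z) (N - (m + n - j - j)))%N); last first.
  rewrite [leqRHS](bigID (mem (~: Z))) /= -[leqLHS]addn0 leq_add //.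
  by apply: leq_sum => s; rewrite inE => /fiber.
rewrite sum_nat_const.
have -> : #|~: Z| = (N - r)%N by rewrite -(cardsC Z) addKn.
have rN : (r <= N)%N by exact: max_card.
have [rl|lr] := leqP r l.
  have -> : j = 0%N by rewrite /j; lia.
  by rewrite !subn0 leq_mul //; lia.
have jE : r = (l + j)%N by rewrite /j; lia.
have j0 : (0 < j)%N by rewrite /j; lia.
have {}lN := lN ltac:(lia).
rewrite jE.
have [X XE] : exists X, N = (l + j + X)%N by exists (N - (l + j))%N; lia.
have [Y YE] : exists Y, N = (m + n + Y)%N \/ (N - (m + n) = 0)%N.
  exists (N - (m + n))%N; lia.
case: YE => [YE|->]; last by rewrite muln0.
have -> : (N - l = X + j)%N by lia.
have -> : (N - (m + n) = Y)%N by lia.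
have -> : (N - (l + j) = X)%N by lia.
have -> : (N - (m + n - j - j) = Y + 2 * j)%N by lia.
(* With [N - l = X + j] the claim is [(X + j) * Y <= X * (Y + 2 * j)]. *)
have : (Y <= 2 * X)%N by lia.
nia.
Qed.

End UnitRoots.

(** * Transporting codewords along a chart *)

Section TorusChart.
Variable F : finFieldType.

Definition unit_expz (x : {unit F}) (z : int) : {unit F} :=
  if z is Negz n then (x ^- n.+1)%g else (x ^+ `|z|%N)%g.

Lemma val_unit_expz x z : val (unit_expz x z) = val x ^ z.
Proof.
by case: z => k; rewrite /unit_expz ?FinRing.val_unitV FinRing.val_unitX.
Qed.

Definition monomial (h : torus F) (a : int * int) : F :=
  val h.1 ^ a.1 * val h.2 ^ a.2.

Lemma monomialD h a b : monomial h (a + b) = monomial h a * monomial h b.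
Proof. by rewrite /monomial /= !expfzDr ?unit_neq0 // mulrACA. Qed.

Lemma monomial_neq0 h a : monomial h a != 0.
Proof. by rewrite mulf_neq0 // expfz_neq0 // unit_neq0. Qed.

Lemma val_unit_expz2 x y z w :
  val (unit_expz x z * unit_expz y w)%g = val x ^ z * val y ^ w.
Proof. by rewrite -!val_unit_expz. Qed.

(** The automorphism of the torus dual to the linear part of the chart. *)
Definition torus_chart (c : chart) (h : torus F) : torus F :=
  ((unit_expz h.1 (c11 c) * unit_expz h.2 (c21 c))%g,
   (unit_expz h.1 (c12 c) * unit_expz h.2 (c22 c))%g).

Lemma monomial_torus_chart c h a :
  monomial (torus_chart c h) a * monomial h (c1 c, c2 c) =
  monomial h (chart_map c a).
Proof.
rewrite -[chart_map c a]/((c11 c)%:~R * a.1 + (c12 c)%:~R * a.2 + (c1 c)%:~R,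
  (c21 c)%:~R * a.1 + (c22 c)%:~R * a.2 + (c2 c)%:~R) !intz.
rewrite /monomial /torus_chart ![fst (_, _)]/= ![snd (_, _)]/=.
rewrite !val_unit_expz2 !expfzMl !exprz_exp !expfzDr ?unit_neq0 //; ring.
Qed.

(** The inverse matrix of the linear part gives the inverse automorphism. *)
Lemma torus_chart_inj c : injective (torus_chart c).
Proof.
pose D := chart_det c.
have D1 : D * c11 c * c22 c - D * c12 c * c21 c = 1.
  by rewrite -[RHS](chart_unimodular c) /D /chart_det; ring.
apply: (@can_inj _ _ _ (fun g : torus F =>
  ((unit_expz g.1 (D * c22 c) * unit_expz g.2 (- (D * c21 c)))%g,
   (unit_expz g.1 (- (D * c12 c)) * unit_expz g.2 (D * c11 c))%g))).
case=> x y; congr (_, _); apply: val_inj;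
  rewrite /torus_chart ![fst (_, _)]/= ![snd (_, _)]/=;
  rewrite !val_unit_expz2 !expfzMl !exprz_exp mulrACA -!expfzDr ?unit_neq0 //.
- rewrite [X in _ ^ X * _](_ : _ = 1); last by rewrite -D1; ring.
  by rewrite [X in _ * _ ^ X](_ : _ = 0) ?expr1z ?expr0z ?mulr1 //; ring.
- rewrite [X in _ ^ X * _](_ : _ = 0); last by ring.
  by rewrite [X in _ * _ ^ X](_ : _ = 1) ?expr1z ?expr0z ?mul1r // -D1; ring.
Qed.

Lemma hamming_weight_torus_chart c (w : {ffun torus F -> F}) :
  hamming_weight w = #|[set h | w (torus_chart c h) != 0]%SET|.
Proof.
rewrite /hamming_weight -!sum1_card (reindex_inj (@torus_chart_inj c)) /=.
by apply: eq_bigl => h; rewrite !inE.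
Qed.

Lemma sum_finsupp_reindex (I : finType) (iota : I -> int * int)
    (f : laurent F) (E : int * int -> F) :
  injective iota -> (forall a, a \in finsupp f -> exists i, iota i = a) ->
  \sum_(a <- finsupp f) f a * E a = \sum_i f (iota i) * E (iota i).
Proof.
move=> inj sub.
rewrite [RHS](bigID (fun i => iota i \in finsupp f)) /= [X in _ + X]big1 ?addr0.
  rewrite -[RHS]big_filter -[RHS](big_map iota xpredT (fun a => f a * E a)).
  apply: perm_big; apply: uniq_perm.
  - exact: fset_uniq.
  - by rewrite map_inj_uniq // filter_uniq // index_enum_uniq.
  move=> a; apply/idP/mapP => [af|[i + ->]];
    last by rewrite mem_filter => /andP[].
  have [i ia] := sub a af; exists i => //.
  by rewrite mem_filter ia af mem_index_enum.
by move=> i; rewrite memNfinsupp => /eqP ->; rewrite mul0r.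
Qed.

(** Up to an invertible monomial, a polynomial supported in [P] becomes one
    supported in the hexagon. *)
Lemma laurent_eval_chart (c : chart) (m n l : nat) (f : laurent F) h :
  (forall a, a \in finsupp f -> hexagon m n l (chart_map c a)) ->
  laurent_eval f (torus_chart c h) * monomial h (c1 c, c2 c) =
  window_eval m n l (fun p => f (chart_inv c p)) h.1 h.2.
Proof.
move=> hf; rewrite ffunE mulr_suml.
transitivity (\sum_(a <- finsupp f) f a * monomial h (chart_map c a)).
  by apply: eq_bigr => a _; rewrite -monomial_torus_chart mulrA.
rewrite /window_eval pair_bigA /=.
pose pt (p : 'I_(m + n).+1 * 'I_(n + l).+1) : int * int :=
  (p.1%:Z - n%:Z, p.2%:Z).
rewrite (@sum_finsupp_reindex _ (fun p => chart_inv c (pt p))) /=.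
- by apply: eq_bigr => p _; rewrite chart_invK.
- move=> p p' /(can_inj (@chart_invK _ c)) [] /addIr [] e1 [] e2.
  by case: p p' e1 e2 => p1 p2 [p1' p2'] /= /val_inj -> /val_inj ->.
move=> a /hf; case aE : (chart_map c a) => [u y].
rewrite /hexagon /= !natz => ha.
have hi : (absz (u + n%:Z)%R < (m + n).+1)%N by lia.
have hk : (absz y < (n + l).+1)%N by lia.
exists (Ordinal hi, Ordinal hk); apply: (can_inj (@chart_mapK _ c)).
by rewrite chart_invK aE /pt /=; congr (_, _); lia.
Qed.

End TorusChart.

(** The weight is invariant under the automorphism of the torus and under
    multiplication by monomials, which reduces to polynomials supported in the
    hexagon. *)
Lemma hamming_weight_ge (F : finFieldType) (c : chart)
    (m n l : nat) (f : laurent F) :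
  let N := #|{: {unit F}}| in
  (n <= m)%N -> (n + l < N)%N -> ((0 < n)%N -> (2 * l + n <= N + m)%N) ->
  (forall a, a \in finsupp f -> hexagon m n l (chart_map c a)) ->
  laurent_eval f != 0 ->
  ((N - l) * (N - (m + n)) <= hamming_weight (laurent_eval f))%N.
Proof.
move=> N nm nlN lN hf fn0.
pose C p := f (chart_inv c p).
have CE p : C p != 0 -> hexagon m n l p.
  by rewrite /C -mem_finsupp => /hf; rewrite chart_invK.
have Cn0 : exists p, C p != 0.
  apply: contrapT => Cz; case/eqP: fn0; apply/ffunP => g.
  rewrite !ffunE big_seq big1 // => a; rewrite mem_finsupp => fa.
  exfalso; apply: Cz; exists (chart_map c a).
  by rewrite /C chart_mapK.
rewrite (hamming_weight_torus_chart c).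
apply: leq_trans (card_torus_nonzeros_ge nm nlN lN CE Cn0) _.
apply/eq_leq/eq_card => h; rewrite !inE -(laurent_eval_chart _ hf).
by rewrite mulf_eq0 (negbTE (monomial_neq0 _ _)) orbF.
Qed.

(** * A codeword of minimal weight *)

Section MinimalCodeword.
Variable F : finFieldType.
Notation N := #|{: {unit F}}|.

(* Formal sums with possibly repeated exponents, on which products can be
   expanded without collecting like terms. *)
Notation terms := (seq (F * (int * int))).

Definition terms_eval (ts : terms) (h : torus F) : F :=
  \sum_(t <- ts) t.1 * monomial h t.2.

Lemma laurent_of_terms (ts : terms) : exists f : laurent F,
  (forall a, a \in finsupp f -> a \in map snd ts) /\
  forall g, laurent_eval f g = terms_eval ts g.
Proof.
pose S : {fset int * int} := [fset a in map snd ts]%fset.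
pose f : laurent F := [fsfun a in S => \sum_(t <- ts | t.2 == a) t.1].
have fE a : f a = \sum_(t <- ts | t.2 == a) t.1.
  rewrite fsfunE; case: ifPn => // aS; rewrite big_seq_cond big1 // => t.
  move=> /andP[tts /eqP ta]; case/negP: aS.
  by rewrite !inE -ta map_f.
have fS : (finsupp f `<=` S)%fset.
  apply/fsubsetP => a; rewrite mem_finsupp; apply: contraR => aS.
  by rewrite fsfunE (negbTE aS).
exists f; split=> [a /(fsubsetP fS)|g]; first by rewrite !inE.
rewrite ffunE (big_fset_incl _ fS) /=; last first.
  by move=> a _; rewrite memNfinsupp => /eqP ->; rewrite mul0r.
transitivity (\sum_(a <- S) \sum_(t <- ts | t.2 == a) t.1 * monomial g t.2).
  apply: eq_bigr => a _; rewrite fE mulr_suml.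
  by apply: eq_bigr => t /eqP ->.
rewrite (exchange_big_dep xpredT) //= /terms_eval big_seq [RHS]big_seq.
apply: eq_bigr => t tts; rewrite -big_filter.
rewrite (_ : [seq a <- S | t.2 == a] = [:: t.2]) ?big_seq1 //.
apply: perm_small_eq => //; apply: uniq_perm => //.
  by rewrite filter_uniq ?fset_uniq.
move=> a; rewrite mem_filter inE eq_sym; case: eqP => // ->.
by rewrite !inE map_f.
Qed.

(** Polynomials enter through the functions they define on the torus, where
    products are pointwise. *)
Definition supported (m n l : nat) (E : torus F -> F) : Prop :=
  exists ts : terms, (forall t, t \in ts -> hexagon m n l t.2) /\
    forall h, terms_eval ts h = E h.

Lemma supported_mul (m n l m' n' l' : nat) (E : torus F -> F) (v : int * int)
    (b : {unit F}) :
  (forall p : int * int, hexagon m n l p ->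
     hexagon m' n' l' p && hexagon m' n' l' (p + v)) ->
  supported m n l E ->
  supported m' n' l' (fun h => (monomial h v - val b) * E h).
Proof.
move=> hv [ts [hts tsE]].
exists ([seq (t.1, t.2 + v) | t <- ts] ++ [seq (- val b * t.1, t.2) | t <- ts]).
split=> [t|h].
  by rewrite mem_cat => /orP[] /mapP[t0 /hts /hv /andP[? ?] ->].
rewrite /terms_eval big_cat !big_map /= -tsE mulrBl !mulr_sumr -sumrN.
congr (_ + _); apply: eq_bigr => t _; last by ring.
by rewrite monomialD; ring.
Qed.

(** Every new factor is a binomial in the monomial of one generator and
    lengthens the corresponding side of the hexagon by one. *)
Lemma supported_zonotope (A B C : seq {unit F}) :
  supported (size A) (size B) (size C) (fun h =>
    \prod_(a <- A) (monomial h (1, 0) - val a) *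
    (\prod_(b <- B) (monomial h (-1, 1) - val b) *
     \prod_(c <- C) (monomial h (0, 1) - val c))).
Proof.
have ext m n l (E E' : torus F -> F) :
    (forall h, E h = E' h) -> supported m n l E -> supported m n l E'.
  by move=> e [ts [h1 h2]]; exists ts; split=> // h; rewrite -e.
elim: A => [|a A IH]; last first.
  apply: ext (supported_mul a _ IH) => [h|p] /=.
    by rewrite big_cons mulrA.
  by rewrite /hexagon /= !natz; lia.
elim: B => [|b B IH]; last first.
  apply: ext (supported_mul b _ IH) => [h|p] /=.
    by rewrite !big_nil !mul1r big_cons mulrA.
  by rewrite /hexagon /= !natz; lia.
elim: C => [|c C IH]; last first.
  apply: ext (supported_mul c _ IH) => [h|p] /=.
    by rewrite !big_nil !mul1r big_cons.
  by rewrite /hexagon /= !natz; lia.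
exists [:: (1, 0)]; split=> [t|h].
  by rewrite inE => /eqP ->; rewrite /hexagon /= !natz; lia.
by rewrite /terms_eval big_seq1 !big_nil /monomial /= !expr0z !mulr1.
Qed.

Local Open Scope set_scope.

(** On a slice [s \notin C] the excluded values of [x] are the elements of [A]
    and the [s * b^-1] with [b \in B]; none of them coincide, because
    [a * b = s] would put [s] into [C]. *)
Lemma card_zonotope_nonzeros (A B C : {set {unit F}}) :
  (forall a b, a \in A -> b \in B -> (a * b)%g \in C) ->
  #|[set h : torus F | [&& h.1 \notin A, (h.1^-1 * h.2)%g \notin B
                         & h.2 \notin C]]|
    = ((N - #|C|) * (N - (#|A| + #|B|)))%N.
Proof.
move=> ABC.
rewrite (card_torus_fibers (fun x s =>
  [&& x \notin A, (x^-1 * s)%g \notin B & s \notin C])).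
rewrite (bigID (mem C)) /= big1 ?add0n => [|s sC]; last first.
  by apply/eqP; rewrite cards_eq0; apply/eqP/setP => x; rewrite !inE sC !andbF.
have -> : (N - #|C| = #|~: C|)%N by rewrite -(cardsC C) addKn.
rewrite -sum_nat_const; apply: eq_big => [s|s sC]; first by rewrite inE.
pose Bs := [set x | (x^-1 * s)%g \in B].
have cBs : #|Bs| = #|B|.
  rewrite -(card_imset (mem Bs) (f := fun x => (x^-1 * s)%g)); last first.
    by move=> x y /mulIg /invg_inj.
  apply: eq_card => b; apply/imsetP/idP => [[x + ->]|bB]; first by rewrite inE.
  by exists (s * b^-1)%g; rewrite ?inE invMg invgK mulgKV.
have dABs : A :&: Bs = finset.set0.
  apply/setP => x; rewrite !inE; apply/negP => /andP[xA xB].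
  by have := ABC _ _ xA xB; rewrite mulKVg (negbTE sC).
transitivity #|~: (A :|: Bs)|.
  by apply: eq_card => x; rewrite !inE sC andbT negb_or.
by rewrite -cBs -(cardsC (A :|: Bs)) cardsU dABs cards0 subn0 addKn.
Qed.

Lemma subset_of_card (T : finType) (S : {set T}) (k : nat) : (k <= #|S|)%N ->
  exists2 A : {set T}, A \subset S & #|A| = k.
Proof.
move=> kS; exists [set x in take k (enum S)].
  by apply/fintype.subsetP => x; rewrite inE => /mem_take; rewrite mem_enum.
rewrite cardsE; have /card_uniqP -> : uniq (take k (enum S)).
  by rewrite take_uniq ?enum_uniq.
by rewrite size_take -cardE; case: ltngtP kS.
Qed.

Lemma unit_subgroup (t : nat) : (t %| N)%N ->
  exists H : {group {unit F}}, #|H| = t.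
Proof.
move=> tN; have /cyclicP[x xE] := field_unit_group_cyclic [set: {unit F}]%G.
have ox : #[x]%g = N by rewrite orderE -xE cardsT.
have N0 : (0 < N)%N by rewrite -ox.
have [k NE] := dvdnP tN; exists <[x ^+ k]>%G.
have k0 : (0 < k)%N by move: N0; rewrite NE muln_gt0 => /andP[].
by rewrite -[LHS]/#[_]%g orderXdiv ox NE ?dvdn_mulr // mulKn.
Qed.

(** The grid lives in a subgroup of order [t], which is closed under products;
    the bounds [m <= t <= l] leave room for [A] and [B] inside it and for [C]
    around it. *)
Lemma unit_grid (m n l t : nat) :
  (n <= m)%N -> (m <= t)%N -> (t <= l)%N -> (t %| N)%N -> (l <= N)%N ->
  exists A B C : {set {unit F}}, [/\ #|A| = m, #|B| = n, #|C| = l &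
    forall a b, a \in A -> b \in B -> (a * b)%g \in C].
Proof.
move=> nm mt tl tN lN; have [H cH] := unit_subgroup tN.
have [A /fintype.subsetP AH cA] :
    exists2 A : {set {unit F}}, A \subset H & #|A| = m.
  by apply: subset_of_card; rewrite cH.
have [B /fintype.subsetP BH cB] :
    exists2 B : {set {unit F}}, B \subset H & #|B| = n.
  by apply: subset_of_card; rewrite cH (leq_trans nm).
have [D DH cD] :
    exists2 D : {set {unit F}}, D \subset ~: H & #|D| = (l - t)%N.
  by apply: subset_of_card; rewrite leq_subLR -cH cardsC.
exists A, B, (H :|: D); split=> //.
  rewrite cardsU cH cD (_ : H :&: D = finset.set0) ?cards0 ?subn0 ?subnKC //.
  by apply/eqP; rewrite finset.setI_eq0 disjoint_sym finset.disjoints_subset.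
by move=> a b /AH aH /BH bH; rewrite inE groupM.
Qed.

End MinimalCodeword.

(** The product of the binomials attached to a multiplicative grid, pulled back
    to [P]. *)
Lemma zonotope_codeword (F : finFieldType) (c : chart) (m n l t : nat) :
  let N := #|{: {unit F}}| in
  (n <= m)%N -> (m <= t)%N -> (t <= l)%N -> (t %| N)%N -> (l <= N)%N ->
  exists f : laurent F,
    (forall a, a \in finsupp f -> hexagon m n l (chart_map c a)) /\
    hamming_weight (laurent_eval f) = ((N - l) * (N - (m + n)))%N.
Proof.
move=> N nm mt tl tN lN.
have [A [B [C [<- <- <- ABC]]]] := unit_grid nm mt tl tN lN.
have [ts [hts tsE]] := supported_zonotope (enum A) (enum B) (enum C).
rewrite -!cardE in hts.
have [f [fts fE]] := laurent_of_terms [seq (t.1, chart_inv c t.2) | t <- ts].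
exists f; split=> [a /fts|].
  rewrite -map_comp => /mapP[t0 /hts + ->] /=.
  by rewrite chart_invK.
rewrite -(card_zonotope_nonzeros ABC) (hamming_weight_torus_chart c).
apply: eq_card => h; rewrite !inE fE.
have -> : terms_eval [seq (t.1, chart_inv c t.2) | t <- ts] (torus_chart c h) !=
    0 = (terms_eval ts h != 0).
  have mn := monomial_neq0 h (c1 c, c2 c).
  rewrite -[in LHS](mulIr_eq0 _ (mulIf mn)) /terms_eval mulr_suml big_map.
  congr (_ != _); apply: eq_bigr => t0 _ /=.
  by rewrite -mulrA monomial_torus_chart chart_invK.
rewrite tsE !mulf_eq0 !negb_or.
have prodE (S : {set {unit F}}) (v : {unit F}) :
    (\prod_(a <- enum S) (val v - val a) != 0) = (v \notin S).
  rewrite prodf_seq_eq0 -[v \in S]mem_enum; congr (~~ _).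
  apply/hasP/idP => [[a aS /=]|vS]; last by exists v => //=; rewrite subrr.
  by rewrite subr_eq0 => /eqP /val_inj ->.
have e1 : monomial h (1, 0) = val h.1.
  by rewrite /monomial /= expr1z expr0z mulr1.
have e2 : monomial h (-1, 1) = val (h.1^-1 * h.2)%g.
  by rewrite /monomial /= expr1z exprN1.
have e3 : monomial h (0, 1) = val h.2.
  by rewrite /monomial /= expr1z expr0z mul1r.
by rewrite e1 e2 e3 !prodE.
Qed.

(** * The minimum distance *)

Theorem corollary4p6 (R : realType) (F : finFieldType) (q : nat)
  (hq : #|F| = q) (P : set (R * R)) (m n l t : nat)
  (hP : lattice_polytope P)
  (hPbox : P `<=` `[0, q%:R - 2] `*` `[0, q%:R - 2])
  (hnm : (n <= m)%N) (hml : (m <= l)%N)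
  (hequiv : lattice_equivalent P
     (minkowski_sum
        (minkowski_sum (dilate m%:R (segment0 e1)) (dilate n%:R (segment0 e2)))
        (dilate l%:R (segment0 (e1 + e2)))))
  (hmt : (m <= t)%N) (htl : (t <= l)%N) (htq : (t %| q - 1)%N)
  (hlarge : area P <
     q%:R - 1 - Num.max (2 * area P - 1) 6 * Num.sqrt q%:R) :
  (min_distance (toric_code F P))%:Z =
    (q%:Z - 1) ^+ 2 - (minkowski_length P)%:Z * (q%:Z - 1)
      + l%:Z * (m%:Z + n%:Z).
Proof.
have [c PE] := lattice_equivalent_chart hequiv.
move: hPbox hlarge; rewrite PE => Pbox large.
have NE : #|{: {unit F}}| = (q - 1)%N.
  by rewrite -cardsT card_finField_unit hq subn1.
have width := box_zonotope_width Pbox hnm hml.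
have area_bound := box_area_bound Pbox hnm hml large.
have LP (f : laurent F) : laurent_space F
    [set p : R * R | hexagon m n l (chart_map c p)] f <->
    forall a, a \in finsupp f -> hexagon m n l (chart_map c a).
  by split=> h a /h; rewrite /= chart_map_lattice hexagon_lattice.
pose W := ((q - 1 - l) * (q - 1 - (m + n)))%N.
have W0 : (0 < W)%N by rewrite muln_gt0; lia.
set Code := toric_code _ _.
have attained : [set hamming_weight w | w in Code `\ 0] W.
  have [||f [/LP fP fW]] :=
    zonotope_codeword c hnm hmt htl (F := F); rewrite ?NE //; first by lia.
  exists (laurent_eval f); last by rewrite fW NE.
  split; first by exists f.
  move=> /= f0; move: W0; rewrite /W -NE -fW f0 /hamming_weight.
  by rewrite eq_card0 // => g; rewrite !inE ffunE eqxx.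
have bound v : [set hamming_weight w | w in Code `\ 0] v -> (W <= v)%N.
  case=> w [[f /LP fP <-] /eqP fn0] <-; rewrite /W -NE.
  by apply: (hamming_weight_ge _ _ _ fP fn0) => //; rewrite NE; lia.
have -> : min_distance Code = W.
  rewrite /min_distance; set S := [set hamming_weight w | w in _].
  apply/eqP; rewrite eqn_leq; apply/andP; split.
    apply: le_infimum_Nmem (attained).
    by exists W; split=> [v /bound|v vl]; last exact: vl attained.
  rewrite /infimum; case: ifPn => [/eqP S0|_].
    by have : S W := attained; rewrite S0.
  case: xgetP => [y -> [yb yl]|none].
    by apply: yl => v /bound.
  by exfalso; apply: (none W); split=> [v /bound|v vl]; last exact: vl attained.
rewrite minkowski_lengthE /W.
rewrite PoszM; have -> : (q - 1 - l)%N%:Z = q%:Z - 1 - l%:Z by lia.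
have -> : (q - 1 - (m + n))%N%:Z = q%:Z - 1 - (m%:Z + n%:Z) by lia.
by rewrite !PoszD; ring.
Qed.
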